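(* Let $\mathbf{K}$ be a finite connected (abstract) simplicial complex and let $G$ be a subgroup of the full automorphism group $\mathrm{aut}(\mathbf{K})$ of $\mathbf{K}$. Then there is a simplicial complex $\mathbf{L}$ such that: (i) $\mathrm{aut}(\mathbf{L})\cong G$; (ii) $|\mathbf{L}|$ is homotopy equivalent to $|\mathbf{K}|$.
   Context: Simplicial complexes are abstract simplicial complexes. For a simplicial complex $\mathbf{K}$ with vertex set $V(\mathbf{K})$, $\mathrm{aut}(\mathbf{K})$ is the group of bijections $f\colon V(\mathbf{K})\to V(\mathbf{K})$ such that both $f$ and $f^{-1}$ send simplices to simplices. $|\mathbf{K}|$ denotes the geometric realization. *)

(* Defs.v *)
From HB Require Import structures.
From mathcomp Require Import all_boot all_order all_algebra finmap.
From mathcomp Require Import boolp classical_sets functions reals topology.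
From mathcomp Require Import normedtype.

Set Implicit Arguments.
Unset Strict Implicit.
Unset Printing Implicit Defensive.

Import Order.TTheory GRing.Theory Num.Theory.
Import numFieldNormedType.Exports.

Local Open Scope classical_set_scope.
Local Open Scope ring_scope.

(* Simplices are nonempty finite sets, and every element of the type [V] is a
   vertex, so that [V] itself is the vertex set; [V] may be infinite. *)
Record simplicialComplex (V : choiceType) := SimplicialComplex {
  simplices : set {fset V};
  simplex_neq0 : ~ simplices fset0;
  simplex_vertex : forall v : V, simplices [fset v]%fset;
  simplex_face : forall s t : {fset V},
    simplices s -> (t `<=` s)%fset -> t != fset0 -> simplices t
}.

Section Automorphisms.
Variables (V : choiceType) (K : simplicialComplex V).

Definition simplicial (f : V -> V) : Prop :=
  forall s : {fset V}, simplices K s -> simplices K [fset f v | v in s]%fset.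

(* The inverse is carried as data but is determined by [aut_fun]; see [aut_ext]. *)
Record aut := Aut {
  aut_fun :> V -> V;
  aut_inv : V -> V;
  aut_funK : cancel aut_fun aut_inv;
  aut_invK : cancel aut_inv aut_fun;
  aut_fun_simplicial : simplicial aut_fun;
  aut_inv_simplicial : simplicial aut_inv
}.

Lemma aut_ext (f g : aut) : f =1 g -> f = g.
Proof.
case: f g => [f f' fK f'K sf sf'] [g g' gK g'K sg sg'] /= /funext fg.
subst g; have e : f' = g' by apply: funext => x; rewrite -{1}(g'K x) fK.
subst g'; congr Aut; exact: Prop_irrelevance.
Qed.

Lemma simplicial_id : simplicial id.
Proof. by move=> s Ks; rewrite imfset_id. Qed.

Lemma simplicial_comp (f g : V -> V) :
  simplicial f -> simplicial g -> simplicial (f \o g).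
Proof.
move=> sf sg s /sg /sf; congr (simplices K _).
apply/fsetP => x; apply/imfsetP/imfsetP => /=.
  by move=> [_ /imfsetP[y /= ys ->] ->]; exists y.
by move=> [y ys ->]; exists (g y) => //; apply/imfsetP; exists y.
Qed.

Definition aut_one : aut :=
  Aut (fun=> erefl) (fun=> erefl) simplicial_id simplicial_id.

Definition aut_mul (f g : aut) : aut :=
  Aut (can_comp (@aut_funK f) (@aut_funK g))
      (can_comp (@aut_invK g) (@aut_invK f))
      (simplicial_comp (@aut_fun_simplicial f) (@aut_fun_simplicial g))
      (simplicial_comp (@aut_inv_simplicial g) (@aut_inv_simplicial f)).

Definition aut_inverse (f : aut) : aut :=
  Aut (@aut_invK f) (@aut_funK f)
      (@aut_inv_simplicial f) (@aut_fun_simplicial f).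

Lemma aut_mulA : associative aut_mul.
Proof. by move=> f g h; apply: aut_ext. Qed.

Lemma aut_1mul : left_id aut_one aut_mul.
Proof. by move=> f; apply: aut_ext. Qed.

Lemma aut_mul1 : right_id aut_one aut_mul.
Proof. by move=> f; apply: aut_ext. Qed.

Lemma aut_Vmul : left_inverse aut_one aut_inverse aut_mul.
Proof. by move=> f; apply: aut_ext => x /=; exact: aut_funK. Qed.

Lemma aut_mulV : right_inverse aut_one aut_inverse aut_mul.
Proof. by move=> f; apply: aut_ext => x /=; exact: aut_invK. Qed.

HB.instance Definition _ := gen_eqMixin aut.
HB.instance Definition _ := gen_choiceMixin aut.
HB.instance Definition _ :=
  isGroup.Build aut aut_mulA aut_1mul aut_mul1 aut_Vmul aut_mulV.

End Automorphisms.

Definition isomorphic_to_subgroup (A B : groupType) (H : {pred B}) : Prop :=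
  exists phi : {multiplicative A -> B}, set_bij [set: A] [set x | x \in H] phi.

Section Realization.
Variables (R : realType) (V : choiceType) (K : simplicialComplex V).

(* Points given by their barycentric coordinates. *)
Record realization := Realization {
  bary : V -> R;
  bary_ge0 : forall v, 0 <= bary v;
  bary_simplex : exists s : {fset V},
    [/\ simplices K s, forall v, v \notin s -> bary v = 0 &
        \sum_(v <- s) bary v = 1]
}.

HB.instance Definition _ := gen_eqMixin realization.
HB.instance Definition _ := gen_choiceMixin realization.

Definition closed_simplex (s : {fset V}) : set realization :=
  [set x | forall v, v \notin s -> bary x v = 0].

(* Weak topology: [U] is open iff its trace on each closed simplex [|s|] is open
   in [|s|].  Points of [|s|] vanish off the finite set [s], so the topology of
   pointwise convergence induces the Euclidean topology on [|s|]. *)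
Definition weak_open : set_system realization :=
  [set U | forall s, simplices K s -> exists O : set {ptws V -> R},
    open O /\ U `&` closed_simplex s = bary @^-1` O `&` closed_simplex s].

Lemma weak_openT : weak_open setT.
Proof. by move=> s _; exists setT; split; [exact: openT|]. Qed.

Lemma weak_openI : setI_closed weak_open.
Proof.
move=> A B oA oB s Ks; have [O [oO AO]] := oA s Ks; have [P [oP BP]] := oB s Ks.
exists (O `&` P); split; first exact: openI.
by rewrite preimage_setI -(setIid (closed_simplex s)) setIACA AO BP setIACA.
Qed.

Lemma weak_open_bigU (I : Type) (f : I -> set realization) :
  (forall i, weak_open (f i)) -> weak_open (\bigcup_i f i).
Proof.
move=> of_ s Ks; have /choice[O oO] i := of_ i s Ks.
exists (\bigcup_i O i); split; first by apply: bigcup_open => i _; case: (oO i).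
rewrite preimage_bigcup !setI_bigcupl; apply: eq_bigcupr => i _.
by case: (oO i).
Qed.

HB.instance Definition _ :=
  isOpenTopological.Build realization weak_openT weak_openI weak_open_bigU.

End Realization.

Definition homotopic (R : realType) (X Y : topologicalType) (f g : X -> Y) :
    Prop :=
  exists H : X * R -> Y,
    [/\ {within [set: X] `*` `[0, 1], continuous H},
        forall x, H (x, 0) = f x & forall x, H (x, 1) = g x].

Definition homotopy_equivalent (R : realType) (X Y : topologicalType) : Prop :=
  exists (f : X -> Y) (g : Y -> X),
    [/\ continuous f, continuous g,
        homotopic R (g \o f) id & homotopic R (f \o g) id].

(* Main.v *)
Require Import Defs.
From HB Require Import structures.
From mathcomp Require Import all_boot all_order all_algebra finmap.
From mathcomp Require Import boolp classical_sets functions reals topology.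
From mathcomp Require Import normedtype.
From mathcomp Require Import zify.

Set Implicit Arguments.
Unset Strict Implicit.
Unset Printing Implicit Defensive.

Import Order.TTheory GRing.Theory Num.Theory.
Import numFieldNormedType.Exports.

Local Open Scope classical_set_scope.

(** Hang copies of the 1-skeleton of [K], one for each element of [G], over [K],
and break their symmetries by threads, so that the only symmetries left are the
translations of [G].

The vertices of the new complex are those of [K] (the base) together with
vertices [(v, g, j)], where [v] is a vertex of [K], [g] is in [G], and [j] is
less than a large constant.  For fixed [g], the tops [(v, g, 0)] form a copy of
the 1-skeleton of [K], the sheet of [g].  For fixed [v] and [g], the [(v, g, j)]
form a path starting at the top, the thread of [v] in sheet [g].  Every vertex
of that thread is joined to [v].  Two vertices of the thread are joined moreover
to all the neighbours of [v] in the base: the top and the one at position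
[colour v g], which encodes the vertex [g^-1 v].  A simplex of the new complex is
a set of vertices that are pairwise joined and lie over a simplex of [K]
([flag_over], [rigid_complex]).

Homotopy type: whatever is joined to [(v, g, j)] is equal or joined to [v], so
the projection to the base is contiguous to the identity.  Contiguous maps are
homotopic along straight lines ([contiguous_homotopic]), hence the realization
of [K] is a deformation retract ([flag_over_homotopy_equivalent]).

Automorphisms ([graph_aut_shape]): the base is recognized by its large degrees;
the two special vertices of a thread are those joined to several base vertices;
the top is the one of these two with a special neighbour off the base; the other
positions are recognized by walking down the thread.  So an automorphism maps the
thread of [v] in sheet [g] to the thread of [a v] in some sheet [h], where [a] is
its restriction to the base.  Since [K] is connected, the sheet [h] depends on
[g] only ([connected_skeleton]).  Since the special positions correspond,
[h^-1 (a v) = g^-1 v] for all [v], so [a] is [h g^-1] and belongs to [G].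
Conversely each [a] in [G] acts by [(v, g, j) |-> (a v, a g, j)].

A complex with at most one vertex, where the special positions cannot be seen
from the base, has no automorphism but the identity and is its own solution. *)

(** * Realizations of finite complexes *)

Section Realizations.
Local Open Scope ring_scope.
Variable R : realType.

Lemma realization_ext (V : choiceType) (K : simplicialComplex V)
  (x y : realization R K) : bary x =1 bary y -> x = y.
Proof.
case: x y => [b b0 bs] [c c0 cs] /= /funext bc; subst c.
congr Realization; exact: Prop_irrelevance.
Qed.

Lemma bary_continuous (V : choiceType) (K : simplicialComplex V) (v : V) :
  continuous (fun x : realization R K => bary x v).
Proof.
apply/continuousP => A oA.
suff : weak_open ((fun x : realization R K => bary x v) @^-1` A) by [].
move=> s _.
exists ((fun f : {ptws V -> R} => f v) @^-1` A); split=> //.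
by move: A oA; apply/continuousP => f; exact: (@proj_continuous V (fun=> R) v f).
Qed.

Lemma bary_support (V : choiceType) (K : simplicialComplex V)
    (x : realization R K) :
  exists2 s, simplices K s & forall v, v \notin s -> bary x v = 0.
Proof. by have [s [Ks xs _]] := bary_simplex x; exists s. Qed.

Lemma big_fset_support (V : finType) (s : {fset V}) (b : V -> R) :
  (forall v, v \notin s -> b v = 0) -> \sum_(v <- s) b v = \sum_v b v.
Proof.
move=> bs; rewrite [RHS](bigID (fun v => v \in s)) /=.
rewrite [X in _ + X]big1 ?addr0; last exact: bs.
rewrite -[RHS]big_filter; apply: perm_big; apply: uniq_perm.
- exact: fset_uniq.
- by rewrite filter_uniq// index_enum_uniq.
- by move=> v; rewrite mem_filter mem_index_enum andbT.
Qed.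

Lemma bary_sum (V : finType) (K : simplicialComplex V) (x : realization R K) :
  \sum_v bary x v = 1.
Proof. by have [s [_ xs <-]] := bary_simplex x; rewrite big_fset_support. Qed.

Lemma realization_of_coordinates (V : finType) (K : simplicialComplex V)
    (T : Type) (B : T -> V -> R) :
    (forall p v, 0 <= B p v) -> (forall p, \sum_v B p v = 1) ->
    (forall p, exists2 s, simplices K s & forall v, v \notin s -> B p v = 0) ->
  exists F : T -> realization R K, forall p, bary (F p) = B p.
Proof.
move=> B0 B1 Bs.
suff H p : exists s : {fset V}, [/\ simplices K s,
    forall v, v \notin s -> B p v = 0 & \sum_(v <- s) B p v = 1].
  by exists (fun p => Realization (B0 p) (H p)).
by have [s Ks ps] := Bs p; exists s; rewrite big_fset_support.
Qed.

(** A complex on finitely many vertices has finitely many simplices, so its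
weak topology is the topology of its barycentric coordinates. *)
Lemma realization_continuous (V : finType) (K : simplicialComplex V)
    (T : topologicalType) (F : T -> realization R K) :
  (forall v, continuous (fun p => bary (F p) v)) -> continuous F.
Proof.
move=> cF; apply/continuousP => U oU; rewrite openE => p Up.
have {}oU : weak_open U by [].
have cB : {for p, continuous (fun q => bary (F q) : {ptws V -> R})}.
  apply/cvg_sup => v A [_ [[B oB <-] Bt] sBA].
  apply: (filterS (fun x H => sBA x H)).
  by apply: cF; apply: open_nbhs_nbhs.
have near_s (s : {fset V}) :
    \forall q \near p, simplices K s -> closed_simplex s (F q) -> U (F q).
  have [Ks|nKs] := pselect (simplices K s); last by apply: nearW => q.
  have [O [oO UO]] := oU s Ks.
  have [ps|/existsNP[v /not_implyP[vs /eqP pv]]] :=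
      pselect (closed_simplex s (F p)).
    have Op : O (bary (F p)).
      suff : (bary (K:=K) @^-1` O `&` closed_simplex s) (F p) by case.
      by rewrite -UO.
    have near_O : \forall q \near p, O (bary (F q)).
      exact: cB O (open_nbhs_nbhs (conj oO Op)).
    apply: filterS near_O => q Oq _ qs.
    suff : (U `&` closed_simplex s) (F q) by case.
    by rewrite UO.
  have : \forall q \near p, bary (F q) v != 0 by exact: (cvgr_neq0 _ (cF v p) pv).
  by apply: filterS => q /eqP qv _ /(_ v vs).
apply: filterS (filter_forall _ near_s) => q qU.
by have [s Ks qs] := bary_support (F q); exact: (qU s Ks qs).
Qed.

End Realizations.

Section SimplicialMaps.
Local Open Scope ring_scope.
Variable R : realType.

Definition simplicial_map (V W : choiceType) (K : simplicialComplex V)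
    (L : simplicialComplex W) (f : V -> W) : Prop :=
  forall s, simplices K s -> simplices L [fset f v | v in s]%fset.

Definition contiguous (V W : choiceType) (K : simplicialComplex V)
    (L : simplicialComplex W) (f g : V -> W) : Prop :=
  forall s, simplices K s ->
    simplices L ([fset f v | v in s] `|` [fset g v | v in s])%fset.

(** The affine extension of [f], in barycentric coordinates. *)
Definition pushforward (V W : finType) (f : V -> W) (b : V -> R) (w : W) : R :=
  \sum_(v | f v == w) b v.

Lemma pushforward_ge0 (V W : finType) (f : V -> W) (b : V -> R) w :
  (forall v, 0 <= b v) -> 0 <= pushforward f b w.
Proof. by move=> b0; apply: sumr_ge0. Qed.

Lemma pushforward_sum (V W : finType) (f : V -> W) (b : V -> R) :
  \sum_w pushforward f b w = \sum_v b v.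
Proof. by rewrite [RHS](partition_big f predT). Qed.

Lemma pushforward_id (V : finType) (b : V -> R) : pushforward id b = b.
Proof. by apply: funext => v; rewrite /pushforward big_pred1_eq. Qed.

Lemma pushforward_comp (U V W : finType) (f : U -> V) (g : V -> W)
  (b : U -> R) : pushforward g (pushforward f b) = pushforward (g \o f) b.
Proof.
apply: funext => w; rewrite /pushforward.
rewrite [RHS](partition_big f (fun v => g v == w)) //=.
apply: eq_bigr => v /eqP gv; apply: eq_bigl => u.
by have [->|] := eqVneq (f u) v; rewrite ?gv ?eqxx ?andbF.
Qed.

Lemma pushforward_support (V W : finType) (f : V -> W) (b : V -> R)
    (s : {fset V}) w :
  (forall v, v \notin s -> b v = 0) -> w \notin [fset f v | v in s]%fset ->
  pushforward f b w = 0.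
Proof.
move=> bs ws; apply: big1 => v /eqP fv; apply: bs; apply: contra ws => vs.
by apply/imfsetP; exists v.
Qed.

Lemma pushforward_continuous (V W : finType) (K : simplicialComplex V)
    (f : V -> W) w :
  continuous (fun x : realization R K => pushforward f (bary x) w).
Proof.
by apply: continuous_big => [|v _]; [exact: add_continuous|exact: bary_continuous].
Qed.

Lemma realization_map_exists (V W : finType) (K : simplicialComplex V)
    (L : simplicialComplex W) (f : V -> W) : simplicial_map K L f ->
  exists2 F : realization R K -> realization R L,
    continuous F & forall x, bary (F x) = pushforward f (bary x).
Proof.
move=> sf.
have [|x|x|F FE] := @realization_of_coordinates R W L (realization R K)
    (fun x => pushforward f (bary x)).
- by move=> x w; apply: pushforward_ge0 => v; exact: bary_ge0.
- by rewrite pushforward_sum bary_sum.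
- have [s Ks xs] := bary_support x; exists [fset f v | v in s]%fset.
    exact: sf.
  by move=> w; apply: pushforward_support.
exists F => //; apply: realization_continuous => w.
under eq_fun do rewrite FE; exact: pushforward_continuous.
Qed.

(** The straight-line homotopy stays in the realization because the images of a
simplex under contiguous maps span a common simplex.  The time parameter is
clamped to the unit interval to make the homotopy a total function. *)
Lemma contiguous_homotopic (V W : finType) (K : simplicialComplex V)
    (L : simplicialComplex W) (f g : V -> W)
    (F G : realization R K -> realization R L) :
    (forall x, bary (F x) = pushforward f (bary x)) ->
    (forall x, bary (G x) = pushforward g (bary x)) ->
  contiguous K L f g -> homotopic R F G.
Proof.
move=> FE GE fg.
pose clamp (t : R^o) : R^o := Order.max 0 (Order.min 1 t).
have clamp_continuous : continuous clamp.
  move=> t; apply: continuous_max; first exact: cvg_cst.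
  by apply: continuous_min; [exact: cvg_cst|exact: cvg_id].
have clamp01 t : 0 <= clamp t <= 1.
  by rewrite /clamp le_max lexx ge_max ler01 ge_min lexx.
pose B (p : realization R K * R) (w : W) :=
  (1 - clamp p.2) * pushforward f (bary p.1) w
  + clamp p.2 * pushforward g (bary p.1) w.
have [|p|p|H HE] := @realization_of_coordinates R W L _ B.
- move=> p w; have /andP[t0 t1] := clamp01 p.2.
  by rewrite addr_ge0 // mulr_ge0 ?subr_ge0 // pushforward_ge0 // => v;
    exact: bary_ge0.
- by rewrite big_split /= -!mulr_sumr !pushforward_sum bary_sum !mulr1 subrK.
- have [s Ks xs] := bary_support p.1.
  exists ([fset f v | v in s] `|` [fset g v | v in s])%fset; first exact: fg.
  move=> w; rewrite inE negb_or => /andP[wf wg].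
  by rewrite /B !(pushforward_support xs)// !mulr0 addr0.
exists H; split.
- apply: continuous_subspaceT; apply: realization_continuous => w.
  under eq_fun do rewrite HE.
  move=> p; rewrite /B; apply: cvgD; apply: cvgM.
  + apply: cvgB; first exact: cvg_cst.
    by apply: continuous_comp; [exact: cvg_snd|exact: clamp_continuous].
  + by apply: (@continuous_comp _ _ _ fst (fun x => pushforward f (bary x) w));
      [exact: cvg_fst|exact: pushforward_continuous].
  + by apply: continuous_comp; [exact: cvg_snd|exact: clamp_continuous].
  + by apply: (@continuous_comp _ _ _ fst (fun x => pushforward g (bary x) w));
      [exact: cvg_fst|exact: pushforward_continuous].
- move=> x; apply: realization_ext => w; rewrite HE FE /B /clamp /=.
  by rewrite (min_idPr ler01) maxxx subr0 mul1r mul0r addr0.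
- move=> x; apply: realization_ext => w; rewrite HE GE /B /clamp /=.
  by rewrite minxx (max_idPr ler01) subrr mul0r mul1r add0r.
Qed.

Lemma homotopy_equivalent_retract (V W : finType) (K : simplicialComplex V)
    (L : simplicialComplex W) (i : V -> W) (r : W -> V) :
    simplicial_map K L i -> simplicial_map L K r -> cancel i r ->
  contiguous L L (i \o r) id ->
  homotopy_equivalent R (realization R L) (realization R K).
Proof.
move=> si sr ir irid.
have [I cI IE] := realization_map_exists si.
have [Q cQ QE] := realization_map_exists sr.
exists Q, I; split=> //.
- apply: (contiguous_homotopic _ _ irid) => x /=.
    by rewrite IE QE pushforward_comp.
  by rewrite pushforward_id.
- apply: (@contiguous_homotopic V V K K id id) => [x|x|s Ks] /=.
  + rewrite QE IE pushforward_comp; congr pushforward.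
    exact/funext.
  + by rewrite pushforward_id.
  + by rewrite fsetUid imfset_id.
Qed.

End SimplicialMaps.

(** * Connectedness *)

Section Connectedness.
Local Open Scope ring_scope.
Variables (R : realType) (V : choiceType) (K : simplicialComplex V).

Lemma vertex_point (v : V) : exists x : realization R K, 0 < bary x v.
Proof.
pose b u : R := (u == v)%:R.
have b0 u : 0 <= b u by rewrite ler0n.
have bs : exists s : {fset V}, [/\ simplices K s,
    forall u, u \notin s -> b u = 0 & \sum_(u <- s) b u = 1].
  exists [fset v]%fset; split; first exact: simplex_vertex.
    by move=> u; rewrite inE /b => /negPf ->.
  by rewrite big_seq_fset1 /b eqxx.
by exists (Realization b0 bs); rewrite /= /b eqxx.
Qed.

Lemma positive_bary (x : realization R K) : exists v, 0 < bary x v.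
Proof.
have [s [_ _ x1]] := bary_simplex x.
apply: contrapT => /forallNP xn; move/eqP: x1.
rewrite big1 ?(eq_sym 0) ?oner_eq0// => v _; apply/eqP.
rewrite eq_le bary_ge0 andbT leNgt; exact/negP/xn.
Qed.

Lemma positive_bary_edge (x : realization R K) u v :
  0 < bary x u -> 0 < bary x v -> simplices K [fset u; v]%fset.
Proof.
move=> xu xv; have [s Ks xs] := bary_support x.
have in_s w : 0 < bary x w -> w \in s.
  by move=> xw; apply: contraLR xw => /xs ->; rewrite ltxx.
apply: (simplex_face Ks); last by apply/fset0Pn; exists u; rewrite !inE eqxx.
by apply/fsubsetP => w; rewrite !inE => /orP[]/eqP->; exact: in_s.
Qed.

(** A union of components of the 1-skeleton would give a clopen part of the
realization, namely the points with a positive coordinate in it. *)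
Lemma connected_skeleton (S : set V) (v : V) :
    connected [set: realization R K] -> S v ->
    (forall u w, S u -> simplices K [fset u; w]%fset -> S w) ->
  forall w, S w.
Proof.
move=> Kconn Sv edgeS w; apply: contrapT => nSw.
pose O (P : set V) := [set x : realization R K | exists2 u, P u & 0 < bary x u].
have openO P : open (O P).
  have -> : O P = \bigcup_(u in P) ((fun x : realization R K => bary x u)
      @^-1` [set t | 0 < t]).
    by apply/seteqP; split=> x [u Pu xu]; exists u.
  apply: bigcup_open => u _.
  have openR : open [set t : R | 0 < t] by exact: open_gt.
  exact: (continuousP _).1 (@bary_continuous R V K u) _ openR.
have OC : O S = ~` O (~` S).
  apply/seteqP; split=> x.
    move=> [u Su xu] [u' nSu' xu']; apply: nSu'; apply: (edgeS u) => //.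
    exact: positive_bary_edge xu xu'.
  move=> nOx; have [u xu] := positive_bary x; exists u => //.
  by apply: contrapT => nSu; apply: nOx; exists u.
have [x xv] := vertex_point v; have [y yw] := vertex_point w.
have : O S = setT.
  apply: Kconn; first by exists x; exists v.
    by exists (O S) => //; rewrite setTI.
  exists (O S); last by rewrite setTI.
  by rewrite OC; exact: open_closedC.
by move/seteqP => [_ /(_ y I)]; rewrite OC; apply; exists w.
Qed.

End Connectedness.

(** * Flag complexes over a complex *)

Section FlagOver.
Variables (V W : choiceType) (K : simplicialComplex V).
Variables (r : W -> V) (e : rel W).
Hypothesis exx : reflexive e.

Let flag_simplices : set {fset W} :=
  [set s : {fset W} | simplices K [fset r x | x in s]%fset /\
           forall x y, x \in s -> y \in s -> e x y].

Let flag_neq0 : ~ flag_simplices fset0.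
Proof. by move=> [+ _]; rewrite imfset0; exact: simplex_neq0. Qed.

Let flag_vertex x : flag_simplices [fset x]%fset.
Proof.
split=> [|y z]; last by rewrite !inE => /eqP-> /eqP->.
by rewrite imfset_fset1; exact: simplex_vertex.
Qed.

Let flag_face (s t : {fset W}) :
  flag_simplices s -> (t `<=` s)%fset -> t != fset0 -> flag_simplices t.
Proof.
move=> [Ks es] /fsubsetP ts /fset0Pn[x xt]; split.
  apply: (simplex_face Ks).
    apply/fsubsetP => _ /imfsetP[y /= yt ->].
    by apply/imfsetP; exists y; first exact: ts.
  by apply/fset0Pn; exists (r x); apply/imfsetP; exists x.
by move=> y z /ts ys /ts zs; exact: es.
Qed.

(** For the complete relation [e] this is [K] with every vertex blown up to the
simplex on its fibre.  Separating pairs of vertices breaks the symmetries of the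
fibres, and the homotopy type survives as long as [e] satisfies the condition of
[flag_over_homotopy_equivalent]. *)
Definition flag_over : simplicialComplex W :=
  SimplicialComplex flag_neq0 flag_vertex flag_face.

Lemma flag_overP s : simplices flag_over s <->
  simplices K [fset r x | x in s]%fset /\
  (forall x y, x \in s -> y \in s -> e x y).
Proof. by []. Qed.

Lemma flag_over_edge x y : symmetric e ->
  simplices flag_over [fset x; y]%fset <->
  e x y /\ simplices K [fset r x; r y]%fset.
Proof.
move=> esym; rewrite flag_overP.
have -> : [fset r z | z in [fset x; y]]%fset = [fset r x; r y]%fset.
  exact: imfset_fset2.
split=> [[Kxy exy]|[exy Kxy]]; split=> //.
  by apply: exy; rewrite !inE eqxx ?orbT.
by move=> u v; rewrite !inE => /orP[]/eqP-> /orP[]/eqP->; rewrite // esym.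
Qed.

End FlagOver.

Lemma simplicial_flag_over (V W : choiceType) (K : simplicialComplex V)
    (r : W -> V) (e : rel W) (exx : reflexive e) (a : V -> V) (f : W -> W) :
    simplicial K a -> (forall x, r (f x) = a (r x)) ->
    (forall x y, e x y -> e (f x) (f y)) ->
  simplicial (flag_over K r exx) f.
Proof.
move=> sa ra ef s [Ks es]; split; last first.
  by move=> _ _ /imfsetP[x /= xs ->] /imfsetP[y /= ys ->]; apply/ef/es.
rewrite -imfset_comp (_ : r \o f = a \o r); last exact/funext.
by rewrite imfset_comp; exact: sa.
Qed.

(** When every neighbour of [x] is also a neighbour of the base point
[i (r x)] below [x], the projection moves each simplex inside a larger one, so
collapsing all of [W] onto the base changes the complex by one contiguity. *)
Lemma flag_over_homotopy_equivalent (R : realType) (V W : finType)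
    (K : simplicialComplex V) (i : V -> W) (r : W -> V) (e : rel W)
    (exx : reflexive e) :
    symmetric e -> cancel i r -> (forall u v, e (i u) (i v)) ->
    (forall x y, e x y -> e (i (r x)) y) ->
  homotopy_equivalent R (realization R (flag_over K r exx)) (realization R K).
Proof.
move=> esym ir ei er; apply: (@homotopy_equivalent_retract R V W K _ i r) => //.
- move=> s Ks; split; last by move=> _ _ /imfsetP[x _ ->] /imfsetP[y _ ->].
  by rewrite -imfset_comp (_ : r \o i = id) ?imfset_id//; exact/funext.
- by move=> s [].
- move=> s [Ks es]; rewrite imfset_id; split.
    rewrite imfsetU -imfset_comp (_ : r \o (i \o r) = r) ?fsetUid//.
    by apply/funext => x /=; rewrite ir.
  move=> x y; rewrite !inE.
  move=> /orP[/imfsetP[{}x /= xs ->]|xs] /orP[/imfsetP[{}y /= ys ->]|ys].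
  + exact: ei.
  + exact/er/es.
  + by rewrite esym; exact/er/es.
  + exact: es.
Qed.

(** * A graph over the vertices with prescribed symmetries *)

Section RigidGraph.
Local Open Scope nat_scope.
Variables (V : finType) (K : simplicialComplex V).
Variables (I : finType) (rho : I -> aut K).

(** Larger than the degree of any vertex off the base; see [degree_thread]. *)
Definition thread_length := (#|V|.*2 + 3).+1.

Notation W := (V + V * I * 'I_thread_length)%type.

Definition base : V -> W := inl.
Definition thread (v : V) (g : I) (j : 'I_thread_length) : W := inr (v, g, j).

(** The position on the thread of [v] in sheet [g] that encodes [g^-1 v].  It is at
least 2 so that the special vertex there is not next to the top. *)
Definition colour (v : V) (g : I) : nat := (enum_rank (aut_inv (rho g) v)).+2.

Definition marked (v : V) (g : I) (j : nat) := (j == 0) || (j == colour v g).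

Definition projection (x : W) : V :=
  match x with inl v => v | inr (v, _, _) => v end.

Definition in_base (x : W) : bool := if x is inl _ then true else false.

Definition adjacent_positions (j k : nat) := (j <= k.+1) && (k <= j.+1).

(** The condition that two vertices over a common simplex be joined.  The base is
complete for this relation, so that it spans a copy of [K]. *)
Definition compatible : rel W := fun x y =>
  match x, y with
  | inl _, inl _ => true
  | inl u, inr (v, g, j) => (u == v) || marked v g j
  | inr (v, g, j), inl u => (u == v) || marked v g j
  | inr (v, g, j), inr (w, h, k) =>
    (g == h) && ((j == 0 :> nat) && (k == 0 :> nat) ||
                 (v == w) && adjacent_positions j k)
  end.

Lemma adjacent_positions_sym : symmetric adjacent_positions.
Proof. by move=> j k; rewrite /adjacent_positions andbC. Qed.

Lemma compatible_refl : reflexive compatible.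
Proof.
by move=> [v|[[v g] j]] //=; rewrite !eqxx /adjacent_positions !leqnSn orbT.
Qed.

Lemma compatible_sym : symmetric compatible.
Proof.
move=> [v|[[v g] j]] [w|[[w h] k]] //=.
by rewrite eq_sym (andbC (k == 0 :> nat)) (eq_sym w) adjacent_positions_sym.
Qed.

Lemma compatible_projection x y :
  compatible x y -> compatible (base (projection x)) y.
Proof.
case: x y => [v|[[v g] j]] [w|[[w h] k]] //= /andP[_ /orP[/andP[_ k0]|/andP[-> //]]].
by rewrite /marked k0 orbT.
Qed.

Definition rigid_complex : simplicialComplex W :=
  flag_over K projection compatible_refl.

Definition kadj (u v : V) : bool := `[< simplices K [fset u; v]%fset >].

(** The 1-skeleton of the rigid complex, with loops. *)
Definition adj : rel W := fun x y =>
  compatible x y && kadj (projection x) (projection y).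

Lemma kadj_refl : reflexive kadj.
Proof. by move=> v; apply/asboolP; rewrite fsetUid; exact: simplex_vertex. Qed.

Lemma kadj_sym : symmetric kadj.
Proof. by move=> u v; rewrite /kadj fsetUC. Qed.

Lemma rigid_edge x y : simplices rigid_complex [fset x; y]%fset <-> adj x y.
Proof.
rewrite /rigid_complex (flag_over_edge _ _ _ _ _ compatible_sym) /adj.
split=> [[-> Kxy]|/andP[xy /asboolP]]; last by split.
exact/asboolP.
Qed.

Lemma colour_lt v g : colour v g < thread_length.
Proof.
rewrite /colour /thread_length; have := ltn_ord (enum_rank (aut_inv (rho g) v)).
by move: (nat_of_ord _) => m; move: #|_|; lia.
Qed.

Definition graph_aut (f f' : W -> W) : Prop :=
  [/\ cancel f f', cancel f' f & {mono f : x y / adj x y}].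

Lemma graph_aut_sym f f' : graph_aut f f' -> graph_aut f' f.
Proof. by move=> [fK f'K fadj]; split=> // x y; rewrite -fadj !f'K. Qed.

Lemma aut_graph_aut (f : aut rigid_complex) : graph_aut f (aut_inv f).
Proof.
split; [exact: aut_funK|exact: aut_invK|move=> x y].
apply/idP/idP => /rigid_edge.
  by move=> /(@aut_inv_simplicial _ _ f); rewrite imfset_fset2 !aut_funK
    => /rigid_edge.
by move=> /(@aut_fun_simplicial _ _ f); rewrite imfset_fset2 => /rigid_edge.
Qed.

(** * Characterizations invariant under graph automorphisms *)

Definition degree (x : W) : nat := #|[pred y | adj x y]|.

Lemma graph_aut_degree f f' x : graph_aut f f' -> degree (f x) = degree x.
Proof.
move=> [fK f'K fadj]; rewrite /degree -[RHS](card_image (can_inj fK)).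
apply: eq_card => y; rewrite inE; apply/idP/fintype.imageP => [xy|[z + ->]].
  by exists (f' y); rewrite ?f'K// inE -fadj f'K.
by rewrite inE fadj.
Qed.

(** A single thread over [v] already gives many neighbours; some sheet is needed,
hence the argument [g]. *)
Lemma degree_base v (g : I) : thread_length <= degree (base v).
Proof.
rewrite -[X in X <= _]card_ord -(@card_image _ _ (thread v g)).
  apply/subset_leq_card/fintype.subsetP => _ /fintype.imageP[j _ ->].
  by rewrite inE /adj /= eqxx kadj_refl.
by move=> j k [].
Qed.

(** Outside the base, a neighbour is in the same sheet, where it is a top or one of
three consecutive vertices of the same thread. *)
Lemma degree_thread v g j : degree (thread v g j) < thread_length.
Proof.
pose s : seq W := codom base ++ codom (fun w => thread w g ord0) ++
  [:: thread v g (inord j.-1); thread v g j; thread v g (inord j.+1)].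
have -> : thread_length = (size s).+1.
  by rewrite /s !size_cat !size_codom /thread_length /=; lia.
rewrite ltnS; apply: leq_trans (card_size _).
apply/subset_leq_card/fintype.subsetP => y.
rewrite inE /adj => /andP[+ _]; rewrite /s !mem_cat.
case: y => [w _|[[w h] k]] /=.
  by rewrite codom_f.
move=> /andP[/eqP <- /orP[/andP[_ /eqP k0]|/andP[/eqP <- /andP[jk kj]]]].
  apply/orP; right; apply/orP; left; apply/codomP; exists w.
  by congr (inr (_, _, _)); apply/val_inj.
apply/orP; right; apply/orP; right; rewrite !inE.
have [->|->|->] : [\/ k = inord j.-1, k = j | k = inord j.+1].
- have k_lt := ltn_ord k; have j_lt := ltn_ord j.
  have [e|[e|e]] : k = j.-1 :> nat \/ k = j :> nat \/ k = j.+1 :> nat by lia.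
  + by apply: Or31; apply/val_inj; rewrite /= inordK -e.
  + by apply: Or32; apply/val_inj.
  + by apply: Or33; apply/val_inj; rewrite /= inordK -e.
- by rewrite eqxx.
- by rewrite eqxx orbT.
- by rewrite eqxx !orbT.
Qed.

Lemma graph_aut_in_base f f' x : graph_aut f f' -> in_base (f x) = in_base x.
Proof.
move=> ff'; have := graph_aut_degree x ff'.
case: x => [v|[[v g] j]]; case: (f _) => [w|[[w h] k]] //= e.
  by have := degree_thread w h k; rewrite ltnNge /thread e degree_base.
by have := degree_thread v g j; rewrite ltnNge /thread -e degree_base.
Qed.

(** An invariant description of the marked vertices of the threads; see
[branching_thread]. *)
Definition branching (x : W) : bool := [exists y, exists z,
  [&& in_base y, in_base z, y != z, adj y x & adj z x]].

Lemma graph_aut_branching f f' x :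
  graph_aut f f' -> branching (f x) = branching x.
Proof.
have imp h h' y : graph_aut h h' -> branching y -> branching (h y).
  move=> hh' /existsP[a /existsP[b /and5P[a0 b0 ab ay b_y]]].
  have [hK _ hadj] := hh'.
  apply/existsP; exists (h a); apply/existsP; exists (h b).
  by rewrite !(graph_aut_in_base _ hh') !hadj (inj_eq (can_inj hK)); apply/and5P.
move=> ff'; apply/idP/idP => [|]; last exact: imp ff'.
by move=> /(imp _ _ _ (graph_aut_sym ff')); case: ff' => fK _ _; rewrite fK.
Qed.

(** An invariant description of the vertices at position 0; see [top_thread]. *)
Definition is_top (x : W) : bool := [&& ~~ in_base x, branching x &
  [exists y, [&& ~~ in_base y, y != x, adj x y & branching y]]].

Lemma graph_aut_top f f' x : graph_aut f f' -> is_top (f x) = is_top x.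
Proof.
have imp h h' y : graph_aut h h' -> is_top y -> is_top (h y).
  move=> hh' /and3P[y0 yb /existsP[a /and4P[a0 ay ya ab]]].
  have [hK _ hadj] := hh'.
  rewrite /is_top (graph_aut_in_base _ hh') (graph_aut_branching _ hh') y0 yb /=.
  apply/existsP; exists (h a).
  by rewrite (graph_aut_in_base _ hh') hadj (inj_eq (can_inj hK))
    (graph_aut_branching _ hh'); apply/and4P.
move=> ff'; apply/idP/idP => [|]; last exact: imp ff'.
by move=> /(imp _ _ _ (graph_aut_sym ff')); case: ff' => fK _ _; rewrite fK.
Qed.

Hypothesis neighbour : forall v, exists2 w, w != v & kadj v w.

Lemma branching_thread v g j : branching (thread v g j) = marked v g j.
Proof.
apply/existsP/idP => [[y /existsP[z /and5P[]]]|m].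
  case: y z => [a|//] [b|//] _ _ ab.
  rewrite /adj /= => /andP[/orP[/eqP av|//] _] /andP[/orP[/eqP bv|//] _].
  by rewrite av bv eqxx in ab.
have [w wv vw] := neighbour v.
exists (base v); apply/existsP; exists (base w).
have bvw : base v != base w by apply: contra wv => /eqP[->].
by rewrite bvw /adj /= m !orbT kadj_refl kadj_sym vw.
Qed.

(** The other marked vertex of the thread has only unmarked neighbours off the base
because [colour] is at least 2, while a top is next to the tops of the adjacent
threads in its sheet. *)
Lemma top_thread v g j : is_top (thread v g j) = (j == 0 :> nat).
Proof.
rewrite /is_top branching_thread; apply/and3P/idP => [[_ m]|/eqP j0].
  case/existsP => y /and4P[]; case: y => [//|[[w h] k]] _ kj.
  rewrite branching_thread /adj /= => /andP[/andP[/eqP gh]] + _; subst h.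
  case/orP => [/andP[//]|/andP[/eqP vw]]; subst w.
  have {kj} kj : k != j :> nat by apply: contra kj => /eqP/val_inj ->.
  move: m kj; rewrite /marked /adjacent_positions /colour; lia.
split=> //; first by rewrite /marked j0.
have [w wv vw] := neighbour v.
apply/existsP; exists (thread w g j).
rewrite branching_thread /marked /adj /= j0 !eqxx vw /= andbT.
by apply: contra wv => /eqP[->].
Qed.

Hypothesis skeleton : forall (S : set V) v, S v ->
  (forall u w, S u -> kadj u w -> S w) -> forall w, S w.

Section Automorphism.
Variables (f f' : W -> W).
Hypothesis ff' : graph_aut f f'.

Let f_inj : injective f. Proof. by case: ff' => /can_inj. Qed.
Let f_adj : {mono f : x y / adj x y}. Proof. by case: ff'. Qed.

Lemma graph_aut_base v : exists u, f (base v) = base u.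
Proof.
have := graph_aut_in_base (base v) ff'.
by case: (f (base v)) => [u|] //= _; exists u.
Qed.

Lemma graph_aut_thread v g j :
  exists w h k, f (thread v g j) = thread w h k /\ (k == 0 :> nat) = (j == 0 :> nat).
Proof.
have := graph_aut_in_base (thread v g j) ff'.
have := graph_aut_top (thread v g j) ff'.
case: (f _) => [//|[[w h] k]]; rewrite !top_thread => kj _.
by exists w, h, k.
Qed.

(** The position along a thread is recognized by walking down from its top,
where the only step that does not go back is the next position. *)
Lemma graph_aut_position v g : exists w h, forall j, f (thread v g j) = thread w h j.
Proof.
have [w [h [k [e0 k0]]]] := graph_aut_thread v g ord0.
exists w, h => j; move: {-1}(j : nat) (erefl (j : nat)) => m.
elim/ltn_ind: m j => -[|m] IH j jm.
  have -> : j = ord0 by apply/val_inj.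
  by rewrite e0; congr (inr (_, _, _)); apply/val_inj/eqP; rewrite k0.
have m_lt : m < thread_length by have := ltn_ord j; lia.
have fm := IH m (ltnSn m) (Ordinal m_lt) erefl.
have [w' [h' [l [fj l0]]]] := graph_aut_thread v g j.
have : adj (thread v g (Ordinal m_lt)) (thread v g j).
  by rewrite /adj /= !eqxx kadj_refl /adjacent_positions jm /= andbT; lia.
rewrite -f_adj fm fj {1}/adj /= => /andP[/andP[/eqP hh' ml] _].
rewrite jm /= in l0; rewrite l0 andbF /= in ml.
move/andP: ml => [/eqP ww' ml]; subst w' h'.
have ml1 : m < l.
  rewrite ltnNge; apply/negP => lm.
  have : thread v g l = thread v g j by apply: f_inj; rewrite (IH l lm l erefl) fj.
  by case=> lj; rewrite lj jm ltnn in lm.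
congr (inr (_, _, _)); apply/val_inj => /=.
by move: ml ml1; rewrite jm /adjacent_positions; lia.
Qed.

(** The vertex at position 1 sees one base vertex only, which ties the image thread
to [a v]; connectedness then makes the image sheet [h] the same for all [v], and
the marked position, being [colour], yields the last equation. *)
Lemma graph_aut_shape (v0 : V) :
  exists2 a : V -> V, forall v, f (base v) = base (a v) &
    forall g, exists h,
      (forall v j, f (thread v g j) = thread (a v) h j) /\
      forall v, rho h (aut_inv (rho g) v) = a v.
Proof.
have [a aE] := choice graph_aut_base; exists a => // g.
have threadE v : exists h, forall j, f (thread v g j) = thread (a v) h j.
  have [w [h fE]] := graph_aut_position v g.
  (* Position 1 is never marked. *)
  have lt1 : 1 < thread_length by rewrite /thread_length; lia.
  have : adj (base v) (thread v g (Ordinal lt1)) by rewrite /adj /= eqxx kadj_refl.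
  rewrite -f_adj aE fE {1}/adj /= /marked /= orbF => /andP[/eqP avw _].
  by exists h; rewrite avw.
have [h hE] := threadE v0.
have {threadE} {}hE : forall v j, f (thread v g j) = thread (a v) h j.
  apply: (@skeleton (fun v => forall j, f (thread v g j) = thread (a v) h j) v0 hE).
  move=> u w fu uw j; have [h' fw] := threadE w.
  have : adj (thread u g ord0) (thread w g ord0) by rewrite /adj /= eqxx.
  by rewrite -f_adj fu fw {1}/adj /= => /andP[/andP[/eqP hh' _] _]; rewrite fw hh'.
exists h; split=> // v.
have : branching (thread v g (Ordinal (colour_lt v g))).
  by rewrite branching_thread /marked eqxx orbT.
rewrite -(graph_aut_branching _ ff') hE branching_thread /marked /=.
by move=> /eqP[/ord_inj/enum_rank_inj ->]; rewrite aut_invK.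
Qed.

End Automorphism.

(** * Symmetries of the graph coming from the index set *)

Definition relabel (a : V -> V) (b : I -> I) (x : W) : W :=
  match x with inl v => base (a v) | inr (v, g, j) => thread (a v) (b g) j end.

(** The marks are respected since [(a g)^-1 (a v) = g^-1 v]. *)
Lemma simplicial_relabel (a : aut K) (b : I -> I) :
  (forall g, rho (b g) = (a * rho g)%g) -> simplicial rigid_complex (relabel a b).
Proof.
move=> bE; apply: (simplicial_flag_over (a := a)).
- exact: aut_fun_simplicial.
- by move=> [v|[[v g] j]].
have markedE v g j : marked (a v) (b g) j = marked v g j.
  by rewrite /marked /colour bE /= aut_funK.
move=> [v|[[v g] j]] [w|[[w h] k]] //=; rewrite ?markedE.
- by move=> /orP[/eqP->|->]; rewrite ?eqxx ?orbT.
- by move=> /orP[/eqP->|->]; rewrite ?eqxx ?orbT.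
- by move=> /andP[/eqP-> /orP[->|/andP[/eqP-> ->]]]; rewrite ?eqxx ?orbT.
Qed.

Lemma relabelK (a a' : V -> V) (b b' : I -> I) :
  cancel a a' -> cancel b b' -> cancel (relabel a b) (relabel a' b').
Proof. by move=> aK bK [v|[[v g] j]] /=; rewrite aK ?bK. Qed.

End RigidGraph.

(** * Realizing a group of automorphisms *)

(** The sheets are indexed by a finite type enumerating [G], so that the new complex
is finite: an automorphism of [K] is determined by its finite graph. *)
Lemma finite_index (V : finType) (K : simplicialComplex V) (G : {pred aut K}) :
  exists (I : finType) (rho : I -> aut K),
    injective rho /\ forall a, a \in G <-> exists g, rho g = a.
Proof.
pose P (p : {ffun V -> V}) := `[< exists2 a : aut K, a \in G & a =1 p >].
pose I : finType := {p | P p}.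
have /choice[rho rhoE] : forall p : I, exists a : aut K, a \in G /\ a =1 val p.
  by move=> p; have /asboolP[a aG ap] := valP p; exists a.
exists I, rho; split=> [p q pq|a].
  by apply/val_inj/ffunP => v; rewrite -(rhoE p).2 -(rhoE q).2 pq.
split=> [aG|[p <-]]; last exact: (rhoE p).1.
have Pa : P [ffun v => a v] by apply/asboolP; exists a => // v; rewrite ffunE.
by exists (Sub _ Pa); apply: aut_ext => v; rewrite (rhoE _).2 SubK ffunE.
Qed.

Section AutomorphismGroup.
Variables (V : finType) (K : simplicialComplex V) (G : {pred aut K}).
Hypothesis Ggrp : group_closed G.
Variables (I : finType) (rho : I -> aut K).
Hypothesis rho_inj : injective rho.
Hypothesis rho_im : forall a, a \in G <-> exists g, rho g = a.
Hypothesis neighbour : forall v, exists2 w, w != v & kadj K v w.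
Hypothesis skeleton : forall (S : set V) v, S v ->
  (forall u w, S u -> kadj K u w -> S w) -> forall w, S w.
Variable v0 : V.

Let translate (a : aut K) (g : I) : I :=
  odflt g [pick h | rho h == (a * rho g)%g].

Let translateE a g : a \in G -> rho (translate a g) = (a * rho g)%g.
Proof.
move=> aG; rewrite /translate; case: pickP => [h /eqP //|nh].
have gG : rho g \in G by apply/rho_im; exists g.
have [h hE] := (rho_im _).1 (group_closedM Ggrp aG gG).
by have := nh h; rewrite hE eqxx.
Qed.

Let relabel_aut (a : aut K) : a \in G ->
  exists f : aut (rigid_complex rho), f =1 relabel a (translate a).
Proof.
move=> aG; have a'G := group_closedV Ggrp aG.
have bK a1 a2 : a1 \in G -> a2 \in G -> (a2 * a1)%g = 1%g ->
    cancel (translate a1) (translate a2).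
  by move=> a1G a2G a21 g; apply: rho_inj; rewrite !translateE// mulgA a21 mul1g.
have lK : cancel (relabel a (translate a))
    (relabel (a^-1)%g (translate (a^-1)%g)).
  by apply: relabelK; [exact: aut_funK|apply: bK; rewrite ?mulVg].
have l'K : cancel (relabel (a^-1)%g (translate (a^-1)%g))
    (relabel a (translate a)).
  by apply: relabelK; [exact: aut_invK|apply: bK; rewrite ?mulgV].
by exists (Aut lK l'K
  (simplicial_relabel (fun g => translateE g aG))
  (simplicial_relabel (fun g => translateE g a'G))).
Qed.

Let aut_relabel (f : aut (rigid_complex rho)) :
  exists a, a \in G /\ f =1 relabel a (translate a).
Proof.
have [a aE threadE] :=
  graph_aut_shape neighbour skeleton (aut_graph_aut f) v0.
have [g0 _] := (rho_im _).1 Ggrp.1.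
have [h0 [_ h0E]] := threadE g0.
pose b := (rho h0 * (rho g0)^-1)%g.
have bE : b =1 a by exact: h0E.
have bG : b \in G by apply: Ggrp.2; apply/rho_im; [exists h0|exists g0].
clearbody b.
exists b; split=> // -[v|[[v g] j]]; first by rewrite [LHS]aE /= bE.
have [h [fE hE]] := threadE g; rewrite [LHS]fE /= bE; congr thread.
apply: rho_inj; rewrite translateE//; apply: aut_ext => u /=.
by rewrite -[u in LHS](aut_funK (rho g)) hE -bE.
Qed.

(** The isomorphism restricts an automorphism to the base. *)
Lemma rigid_complex_aut : isomorphic_to_subgroup (aut (rigid_complex rho)) G.
Proof.
have [phi phiP] := choice aut_relabel.
have phi_base (f : aut (rigid_complex rho)) v :
  f (base I v) = base I (phi f v) by rewrite (phiP f).2.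
have phiM : {morph phi : f g / (f * g)%g}.
  move=> f g; apply: aut_ext => v.
  have : base I (phi (f * g)%g v) = base I ((phi f * phi g)%g v) :> _.
    by rewrite -!phi_base.
  by case.
pose Phi : {multiplicative aut (rigid_complex rho) -> aut K} :=
  HB.pack phi (isMultiplicative.Build _ _ phi phiM).
exists Phi; split=> [f _|f g _ _ fg|a aG].
- exact: (phiP f).1.
- apply: aut_ext => x; rewrite (phiP f).2 (phiP g).2.
  by have -> : phi f = phi g by exact: fg.
- have [f fE] := relabel_aut aG; exists f => //.
  apply: aut_ext => v; have := phi_base f v; rewrite fE => -[->] //.
Qed.

End AutomorphismGroup.

Theorem theorem3 (R : realType) (V : finType) (K : simplicialComplex V)
    (Kconn : connected [set: realization R K])
    (G : {pred aut K}) (Ggrp : group_closed G) :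
  exists (W : choiceType) (L : simplicialComplex W),
    isomorphic_to_subgroup (aut L) G /\
    homotopy_equivalent R (realization R L) (realization R K).
Proof.
have [V1|V2] := leqP #|V| 1.
  have autK1 (a : aut K) : a = 1%g by apply: aut_ext => v; apply: (card_le1_eqP V1).
  exists V, K; split.
    exists (idfun : {multiplicative aut K -> aut K}); split=> [a _|//|a aG].
      by rewrite /= (autK1 a); exact: Ggrp.1.
    by exists a.
  apply: (@homotopy_equivalent_retract R V V K K id id) => // s Ks.
  - by rewrite imfset_id.
  - by rewrite imfset_id.
  - by rewrite fsetUid imfset_id.
have [v0 _] : exists v : V, v \in V by apply/card_gt0P; exact: ltn_trans V2.
have skeleton (S : set V) v : S v ->
    (forall u w, S u -> kadj K u w -> S w) -> forall w, S w.
  move=> Sv SK; apply: (connected_skeleton Kconn Sv) => u w Su uw.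
  by apply: SK Su _; exact/asboolP.
have neighbour v : exists2 w, w != v & kadj K v w.
  apply: contrapT => nv.
  have eq_v : forall w, w = v.
    apply: (skeleton [set v]) => // u w -> vw /=.
    by apply: contrapT => /eqP wv; apply: nv; exists w.
  by move: V2; rewrite ltnNge => /negP; apply; apply/card_le1_eqP => x y _ _;
    rewrite (eq_v x).
have [I [rho [rho_inj rho_im]]] := finite_index G.
exists (V + V * I * 'I_(thread_length V))%type, (rigid_complex rho); split.
  exact: rigid_complex_aut.
apply: (@flag_over_homotopy_equivalent R V _ K (base I)) => //.
- exact: compatible_sym.
- exact: compatible_projection.
Qed.
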